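(* Let $A$ be a finite-dimensional left-symmetric algebra over a field $\mathbb{F}$ of characteristic zero. If $A$ is a Novikov algebra or a derivation algebra, then $Z(A)=\mathcal{Z}_A$.
   Context: A left-symmetric algebra over $\mathbb{F}$ is a vector space $A$ over $\mathbb{F}$ with a bilinear product $\cdot$ such that $(x,y,z)=(y,x,z)$ for all $x,y,z\in A$, where $(x,y,z)=(x\cdot y)\cdot z-x\cdot(y\cdot z)$ is the associator. Its associated Lie algebra $\mathcal{G}_A$ is $A$ with bracket $[x,y]=x\cdot y-y\cdot x$, and $\mathcal{Z}_A$ denotes the center of the Lie algebra $\mathcal{G}_A$. A left-symmetric algebra is a Novikov algebra if $(x\cdot y)\cdot z=(x\cdot z)\cdot y$ for all $x,y,z$, and a derivation algebra if $(x\cdot y)\cdot z=(z\cdot y)\cdot x$ for all $x,y,z$. The center $Z(A)$ is the set of all $z\in A$ such that $x\cdot z=z\cdot x$ for all $x\in A$ and $(z,x,y)=(x,z,y)=(x,y,z)=0$ for all $x,y\in A$. *)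

(* Defs.v *)
From HB Require Import structures.
From mathcomp Require Import all_boot all_order all_algebra.
From mathcomp Require Import sesquilinear.
From mathcomp Require Import mathcomp_extra boolp classical_sets.

Set Implicit Arguments.
Unset Strict Implicit.
Unset Printing Implicit Defensive.

Import GRing.Theory.

Local Open Scope ring_scope.
Local Open Scope classical_set_scope.

Section LieAlgebra.
Variables (F : fieldType) (A : lmodType F).

Definition is_lie_bracket (br : {bilinear A -> A -> A}) : Prop :=
  (forall x, br x x = 0) /\
  (forall x y z, br x (br y z) + br y (br z x) + br z (br x y) = 0).

Definition lie_center (br : A -> A -> A) : set A :=
  [set z | forall x, br z x = 0].

End LieAlgebra.

(* The product of a nonassociative algebra on A is a mere bilinear map, since
   the ring and algebra structures of the library are associative and unital. *)
Section NonassociativeAlgebra.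
Variables (F : fieldType) (A : lmodType F) (mul : {bilinear A -> A -> A}).

Definition associator (x y z : A) : A :=
  mul (mul x y) z - mul x (mul y z).

Definition left_symmetric : Prop :=
  forall x y z, associator x y z = associator y x z.

Definition novikov_identity : Prop :=
  forall x y z, mul (mul x y) z = mul (mul x z) y.

Definition derivation_identity : Prop :=
  forall x y z, mul (mul x y) z = mul (mul z y) x.

Definition commutator (x y : A) : A := mul x y - mul y x.

Fact commutator_bilinear : bilinear_for *:%R *:%R commutator.
Proof.
by split=> [u a x y|u a x y] /=; rewrite /commutator linearPl linearPr;
  rewrite scalerBr opprD addrACA.
Qed.

HB.instance Definition _ :=
  bilinear_isBilinear.Build F A A A *:%R *:%R commutator commutator_bilinear.

Definition algebra_center : set A :=
  [set z | (forall x, mul x z = mul z x) /\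
           (forall x y, [/\ associator z x y = 0,
                            associator x z y = 0 &
                            associator x y z = 0])].

Lemma commutator_lie : left_symmetric -> is_lie_bracket commutator.
Proof.
move=> ls; split=> [x|x y z]; first exact: subrr.
have s u v w : mul (commutator u v) w = mul u (mul v w) - mul v (mul u w).
  have /eqP := ls u v w; rewrite subr_eq => /eqP e.
  by rewrite linearBl e addrC -!addrA addKr addrC.
have e u v w : commutator u (commutator v w) =
    (mul u (mul v w) + mul w (mul v u)) - (mul u (mul w v) + mul v (mul w u)).
  by rewrite {1}/commutator s linearBr opprB addrACA -opprD.
rewrite /= !e (addrC (mul y (mul z x))) subrKA.
rewrite (addrC (mul z (mul x y))) subrKA.
by rewrite (addrC (mul z (mul y x))) subrr.
Qed.

End NonassociativeAlgebra.

(* Main.v *)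
Require Import Defs.
From mathcomp Require Import all_boot all_order all_algebra.
From mathcomp Require Import sesquilinear.
From mathcomp Require Import boolp classical_sets.

Set Implicit Arguments.
Unset Strict Implicit.
Unset Printing Implicit Defensive.

Import GRing.Theory.

Local Open Scope ring_scope.
Local Open Scope classical_set_scope.

(** Only the vanishing of the associators is at stake. If [z] commutes with everything, then
    [z(xy) = (xy)z], and either identity turns this into [(xz)y = (zx)y], so [(z,x,y) = 0]. Left
    symmetry gives [(x,z,y) = 0], and commuting [z] carries this over to [(x,y,z)]. *)

Theorem lemma11 (F : fieldType) (A : vectType F) (mul : {bilinear A -> A -> A})
  (charF0 : [pchar F] =i pred0) (lsA : left_symmetric mul)
  (hA : novikov_identity mul \/ derivation_identity mul) :
  algebra_center mul = lie_center (commutator mul).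
Proof.
apply/seteqP; split=> z; rewrite /algebra_center /lie_center /=.
  by case=> zC _ x; rewrite /commutator zC subrr.
move=> zC0; have zC x : mul x z = mul z x.
  by apply/esym/subr0_eq; exact: zC0.
split=> // x y; have zxyE : mul (mul z x) y = mul z (mul x y).
  case: hA => [novA|derA]; first by rewrite -[RHS]zC [RHS]novA zC.
  (* The derivation identity is applied twice, commuting [z] in between:
     [(xy)z = (zy)x = (yz)x = (xz)y]. *)
  by rewrite -[RHS]zC [RHS]derA -[mul z y]zC [RHS]derA zC.
have zxy0 : associator mul z x y = 0 by rewrite /associator zxyE subrr.
have xzy0 : associator mul x z y = 0 by rewrite lsA.
(* [(x,y,z) = (x,z,y)]: both equal [z(xy) - x(zy)] once [z] is moved to the left. *)
by split=> //; rewrite -[RHS]xzy0 /associator !zC zxyE.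
Qed.
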